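(* Let $\Phi=(\phi_1,\dots,\phi_K)$, $\phi_i\in\mathbb{R}^d$, be a unit norm tight frame with frame constant $A=K/d$ and coherence $\mu$. Let $c\in\mathbb{R}^K$ satisfy $c_1\ge c_2\ge\dots\ge c_K\ge 0$ and $\|c\|_2=1$, and let $x=c_{p,\sigma}$ with probability $(2^K K!)^{-1}$ for each permutation $p$ of $\{1,\dots,K\}$ and each sign sequence $\sigma\in\{-1,1\}^K$; set $y=\Phi x$. If $c_1>c_2+2\mu\|c\|_1$, then $\Phi$ is a local maximum of $$\max_{\Psi\in\mathcal D}\ \mathbb{E}_y\big(\|\Psi^\star y\|_\infty^2\big).$$ Moreover, for every $\Psi=(\psi_1,\dots,\psi_K)\in\mathcal D$ with $0<\max_i\|\psi_i-\phi_i\|_2\le\varepsilon$ we have $\mathbb{E}_x\|\Psi^\star\Phi x\|_\infty^2<\mathbb{E}_x\|\Phi^\star\Phi x\|_\infty^2$ as soon as $\varepsilon<1/5$ and $$\varepsilon\le\frac{\Big(1-2\frac{c_2+\mu\|c\|_1}{c_2+c_1}\Big)^2}{2A\log\Big(2AK\big/\big(c_1^2-\frac{1-c_1^2}{K-1}\big)\Big)}.$$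
   Context: $\mathcal D$ denotes the set of dictionaries $\Psi=(\psi_1,\dots,\psi_K)$ with $\psi_i\in\mathbb{R}^d$, $\|\psi_i\|_2=1$. A unit norm tight frame with frame constant $A$ is a dictionary in $\mathcal D$ with $\sum_{i=1}^K|\langle\phi_i,v\rangle|^2=A\|v\|_2^2$ for all $v\in\mathbb{R}^d$ (so $A=K/d$). The coherence is $\mu=\max_{i\neq j}|\langle\phi_i,\phi_j\rangle|$. For a sequence $c\in\mathbb{R}^K$, a permutation $p$ and signs $\sigma$, $c_{p,\sigma}\in\mathbb{R}^K$ is defined componentwise by $c_{p,\sigma}(i)=\sigma_i c_{p(i)}$. $\Psi^\star$ denotes the transpose. *)

(* Defs.v *)
From HB Require Import structures.
From Stdlib Require Import Reals.
From mathcomp Require Import all_boot all_fingroup.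
Set Implicit Arguments. Unset Strict Implicit. Unset Printing Implicit Defensive.

Local Open Scope R_scope.

Lemma Rplus_assoc' : associative Rplus.
Proof. by move=> x y z; rewrite Rplus_assoc. Qed.
HB.instance Definition _ := Monoid.isComLaw.Build R 0 Rplus Rplus_assoc' Rplus_comm Rplus_0_l.

Definition dot (d : nat) (u v : 'I_d -> R) : R := \big[Rplus/0]_(j < d) (u j * v j).
Definition norm2 (d : nat) (u : 'I_d -> R) : R := sqrt (dot u u).
Definition linf (n : nat) (v : 'I_n -> R) : R :=
  foldr Rmax 0 [seq Rabs (v i) | i <- enum 'I_n].

Definition dict (d K : nat) := 'I_K -> 'I_d -> R.

Definition in_D (d K : nat) (Psi : dict d K) : Prop := forall i, norm2 (Psi i) = 1.

Definition is_untf (d K : nat) (Phi : dict d K) (A : R) : Prop :=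
  in_D Phi /\ forall v : 'I_d -> R, \big[Rplus/0]_(i < K) (dot (Phi i) v) ^ 2 = A * dot v v.

Definition coherence (d K : nat) (Phi : dict d K) : R :=
  foldr Rmax 0 [seq Rabs (dot (Phi ij.1) (Phi ij.2))
               | ij <- enum [pred ij : 'I_K * 'I_K | ij.1 != ij.2]].

Definition analysis (d K : nat) (Psi : dict d K) (v : 'I_d -> R) : 'I_K -> R :=
  fun i => dot (Psi i) v.

Definition synthesis (d K : nat) (Phi : dict d K) (x : 'I_K -> R) : 'I_d -> R :=
  fun j => \big[Rplus/0]_(i < K) (x i * Phi i j).

(* the coefficient sequence c is given as c : nat -> R, with c_1,...,c_K the
   values c 0, ..., c (K-1) (0-based indexing). *)
Definition sgn (b : bool) : R := if b then -1 else 1.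

Definition cps (K : nat) (c : nat -> R) (p : {perm 'I_K}) (s : {ffun 'I_K -> bool}) : 'I_K -> R :=
  fun i => sgn (s i) * c (nat_of_ord (p i)).

Definition Ex (K : nat) (c : nat -> R) (f : ('I_K -> R) -> R) : R :=
  / (INR (2 ^ K)%N * INR (K `!)%N) *
  \big[Rplus/0]_(p : {perm 'I_K}) \big[Rplus/0]_(s : {ffun 'I_K -> bool}) f (cps c p s).

Definition objective (d K : nat) (Phi : dict d K) (c : nat -> R) (Psi : dict d K) : R :=
  Ex c (fun x => (linf (analysis Psi (synthesis Phi x))) ^ 2).

Definition dict_dist (d K : nat) (Psi Phi : dict d K) : R :=
  foldr Rmax 0 [seq norm2 (fun j => Psi i j - Phi i j) | i <- enum 'I_K].

Definition local_max_on_D (d K : nat) (F : dict d K -> R) (Phi : dict d K) : Prop :=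
  exists r : R, 0 < r /\
    forall Psi : dict d K, in_D Psi -> dict_dist Psi Phi < r -> F Psi <= F Phi.

(* Main.v *)
(** Write [psi_j = alpha_j phi_j + r_j] with [r_j] orthogonal to [phi_j] (the tilt), put
    [w_j = |r_j|^2 = 1 - alpha_j^2], and let [i] be the index that carries the largest
    coefficient [c_1].  For a fixed permutation the correlations [<r_j, y>] are Rademacher
    sums, of variance at most [A w_j c_2^2] for [j = i] (because [r_i] does not see [phi_i])
    and at most [A w_j c_1^2] otherwise.  Unless one of them exceeds [c_2 t], resp. [c_1 t],
    with [t = delta - eps^2/2] and [delta = (c_1 - c_2 - 2 mu |c|_1) / (c_1 + c_2)], the
    maximal correlation of [y] with [Psi] is attained at [i].  Hoeffding's inequality and
    [|Psi^* y|_oo^2 <= A] bound the contribution of the exceptional signs by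
    [2 A sum_j exp (- t^2 / (2 A w_j))], whereas replacing [psi_i] by [phi_i] in
    [E <psi_i, y>^2] gains exactly [(lambda / K) sum_j w_j] with
    [lambda = c_1^2 - (1 - c_1^2) / (K - 1)].  The bound on [eps] makes the gain larger,
    term by term. *)

Require Import Defs.
From HB Require Import structures.
From Stdlib Require Import Reals Psatz FunctionalExtensionality.
From Coquelicot Require Import Coquelicot.
From mathcomp Require Import all_boot all_fingroup.
Set Implicit Arguments. Unset Strict Implicit. Unset Printing Implicit Defensive.
Local Open Scope R_scope.

Local Arguments pow : simpl never.

Local Notation "\sum_ ( i <- r | P ) F" := (\big[Rplus/0]_(i <- r | P%B) F) : R_scope.
Local Notation "\sum_ ( i | P ) F" := (\big[Rplus/0]_(i | P%B) F) : R_scope.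
Local Notation "\sum_ ( i 'in' A ) F" := (\big[Rplus/0]_(i in A) F) : R_scope.
Local Notation "\sum_ i F" := (\big[Rplus/0]_i F) : R_scope.
Local Notation "\sum_ ( i : t ) F" := (\big[Rplus/0]_(i : t) F) : R_scope.
Local Notation "\sum_ ( i < n ) F" := (\big[Rplus/0]_(i < n) F) : R_scope.
Local Notation "\prod_ ( i <- r | P ) F" := (\big[Rmult/1]_(i <- r | P%B) F) : R_scope.
Local Notation "\prod_ ( i : t ) F" := (\big[Rmult/1]_(i : t) F) : R_scope.
Local Notation "\prod_ i F" := (\big[Rmult/1]_i F) : R_scope.

Lemma RmultA : associative Rmult.
Proof. by move=> x y z; rewrite Rmult_assoc. Qed.

HB.instance Definition _ :=
  Monoid.isMulLaw.Build R 0 Rmult Rmult_0_l Rmult_0_r.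
HB.instance Definition _ :=
  Monoid.isComLaw.Build R 1 Rmult RmultA Rmult_comm Rmult_1_l.
HB.instance Definition _ :=
  Monoid.isAddLaw.Build R Rmult Rplus Rmult_plus_distr_r Rmult_plus_distr_l.

Section FiniteSums.
Variables (I : Type) (r : seq I) (P : pred I).
Implicit Types F G : I -> R.

Lemma Rsum_le F G : (forall i, P i -> F i <= G i) ->
  \sum_(i <- r | P i) F i <= \sum_(i <- r | P i) G i.
Proof.
move=> le_FG; apply: (big_ind2 (fun x y => x <= y)) => // *; first lra.
exact: Rplus_le_compat.
Qed.

Lemma Rsum_ge0 F : (forall i, P i -> 0 <= F i) -> 0 <= \sum_(i <- r | P i) F i.
Proof.
by move=> F_ge0; apply: (big_ind (fun x => 0 <= x)) => // *; lra.
Qed.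

Lemma Rabs_sum_le F :
  Rabs (\sum_(i <- r | P i) F i) <= \sum_(i <- r | P i) Rabs (F i).
Proof.
apply: (big_ind2 (fun x y => Rabs x <= y)) => [|x1 x2 y1 y2 abs_x1 abs_y1|*].
- by rewrite Rabs_R0; lra.
- by have := Rabs_triang x1 y1; lra.
- exact: Rle_refl.
Qed.

Lemma Rprod_le F G : (forall i, P i -> 0 <= F i <= G i) ->
  \prod_(i <- r | P i) F i <= \prod_(i <- r | P i) G i.
Proof.
move=> FG; apply: (@proj2 (0 <= \prod_(i <- r | P i) F i)).
apply: (big_ind2 (fun x y => 0 <= x /\ x <= y)) => [|x1 x2 y1 y2 [? ?] [? ?]|//].
  by lra.
by split; [exact: Rmult_le_pos|exact: Rmult_le_compat].
Qed.

Lemma exp_sum F :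
  exp (\sum_(i <- r | P i) F i) = \prod_(i <- r | P i) exp (F i).
Proof. exact: (big_morph exp exp_plus exp_0). Qed.

End FiniteSums.

Section FiniteTypeSums.
Variable I : finType.
Implicit Types F G u v : I -> R.

Lemma Rsum_lt (P : pred I) F G (i0 : I) : P i0 ->
  (forall i, P i -> F i <= G i) -> F i0 < G i0 ->
  \sum_(i | P i) F i < \sum_(i | P i) G i.
Proof.
move=> Pi0 le_FG lt_FG; rewrite (bigD1 i0) // [X in _ < X](bigD1 i0) //=.
by apply: Rplus_lt_le_compat => //; apply: Rsum_le => i /andP[/le_FG].
Qed.

Lemma Rsum_ge_term F (i : I) : (forall j, 0 <= F j) -> F i <= \sum_j F j.
Proof.
move=> F_ge0; rewrite (bigD1 i) //=.
by have := @Rsum_ge0 _ (index_enum I) (fun j => j != i) F (fun j _ => F_ge0 j); lra.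
Qed.

Lemma Rsum_const (P : pred I) (x : R) : \sum_(i | P i) x = INR #|P| * x.
Proof.
rewrite big_const; elim: #|P| => [|n IHn]; first by rewrite /=; lra.
by rewrite iterS IHn S_INR; lra.
Qed.

Lemma Rprod_const (x : R) : \prod_(i : I) x = x ^ #|I|.
Proof. by rewrite big_const; elim: #|I| => //= n ->. Qed.

Lemma sum_sqr_ge0 u : 0 <= \sum_i u i ^ 2.
Proof. by apply: Rsum_ge0 => i _; apply: pow2_ge_0. Qed.

Lemma sum_sqr_eq0 u : \sum_i u i ^ 2 <= 0 -> forall i, u i = 0.
Proof.
move=> u0 i; have := @Rsum_ge_term (fun i => u i ^ 2) i (fun i => pow2_ge_0 _).
by move=> ui_le; apply: Rsqr_0_uniq; have := pow2_ge_0 (u i); rewrite Rsqr_pow2; lra.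
Qed.

Lemma cauchy_schwarz_sum u v :
  (\sum_i u i * v i) ^ 2 <= (\sum_i u i ^ 2) * (\sum_i v i ^ 2).
Proof.
set C := \sum_i u i * v i; set U := \sum_i u i ^ 2; set V := \sum_i v i ^ 2.
have [U_ge0 V_ge0] : 0 <= U /\ 0 <= V by split; apply: sum_sqr_ge0.
have expand x y :
    \sum_i (x * u i + y * v i) ^ 2 = x ^ 2 * U + (2 * x * y * C + y ^ 2 * V).
  by rewrite !big_distrr -!big_split; apply: eq_bigr => i _ /=; ring.
case: (Rle_lt_dec V 0) => [V_le0|V_gt0].
  have -> : C = 0 by apply: big1 => i _; rewrite (sum_sqr_eq0 V_le0); ring.
  by rewrite pow_i; [exact: Rmult_le_pos|lia].
have := sum_sqr_ge0 (fun i => V * u i + - C * v i); rewrite expand => ge0.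
by apply: (Rmult_le_reg_l V) => //; lra.
Qed.

End FiniteTypeSums.
Arguments Rsum_lt {I P F G}.

Section ExponentialBounds.
Implicit Types x y : R.

Lemma exp_le x y : x <= y -> exp x <= exp y.
Proof. by case=> [/exp_increasing/Rlt_le|->] //; apply: Rle_refl. Qed.

Lemma le_of_is_derive_ge0 (f f' : R -> R) (a b : R) : a <= b ->
  (forall x, a <= x <= b -> is_derive f x (f' x)) ->
  (forall x, a <= x <= b -> 0 <= f' x) -> f a <= f b.
Proof.
case=> [lt_ab|->] deriv_f f'_ge0; last exact: Rle_refl.
have [x [diff_f x_ab]] : exists x, f b - f a = f' x * (b - a) /\ a < x < b.
  by apply: MVT_cor2 => // x x_ab; apply/is_derive_Reals/deriv_f.
by have := f'_ge0 x ltac:(lra); nra.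
Qed.

Lemma sinh_ge0 x : 0 <= x -> 0 <= sinh x.
Proof. by move=> x_ge0; rewrite /sinh; have := @exp_le (- x) x ltac:(lra); lra. Qed.

Lemma sinh_le_mul_cosh x : 0 <= x -> sinh x <= x * cosh x.
Proof.
move=> x_ge0; pose f y := y * cosh y - sinh y.
have : f 0 <= f x.
  apply: (@le_of_is_derive_ge0 f (fun y => y * sinh y)) => // y y_0x.
    by rewrite /f; auto_derive => //; ring.
  by apply: Rmult_le_pos; [lra|apply: sinh_ge0; lra].
by rewrite /f sinh_0; lra.
Qed.

Lemma cosh_le_exp_half_sqr x : cosh x <= exp (x ^ 2 / 2).
Proof.
wlog x_ge0 : x / 0 <= x => [ge0_case|].
  case: (Rle_lt_dec 0 x) => [/ge0_case //|x_lt0].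
  have := ge0_case (- x) ltac:(lra).
  by rewrite /cosh Ropp_involutive Rplus_comm -!Rsqr_pow2 -Rsqr_neg.
pose f y := - (exp (- (y ^ 2 / 2)) * cosh y).
have : f 0 <= f x.
  apply: (@le_of_is_derive_ge0 f
    (fun y => exp (- (y ^ 2 / 2)) * (y * cosh y - sinh y))) => // y y_0x.
    by rewrite /f; auto_derive => //; rewrite /Rdiv /=; field.
  have := @sinh_le_mul_cosh y ltac:(lra); have := exp_pos (- (y ^ 2 / 2)).
  by move=> *; apply: Rmult_le_pos; lra.
rewrite /f cosh_0 (_ : - (0 ^ 2 / 2) = 0) ?exp_0; last by field.
rewrite exp_Ropp => cosh_le; have e_gt0 := exp_pos (x ^ 2 / 2).
apply: (Rmult_le_reg_l (/ exp (x ^ 2 / 2))); first exact: Rinv_0_lt_compat.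
by rewrite Rinv_l; lra.
Qed.

End ExponentialBounds.

Definition lt_indicator (x y : R) : R := if Rlt_dec x y then 1 else 0.

Lemma lt_indicator_ge0 (x y : R) : 0 <= lt_indicator x y.
Proof. by rewrite /lt_indicator; case: (Rlt_dec x y) => ? /=; lra. Qed.

Lemma lt_indicator_lt1 (x y : R) : lt_indicator x y < 1 <-> y <= x.
Proof. by rewrite /lt_indicator; case: (Rlt_dec x y) => ? /=; lra. Qed.

Lemma lt_indicator_abs_le_exp (theta u x : R) : 0 <= theta ->
  lt_indicator u (Rabs x)
  <= exp (- (theta * u)) * (exp (theta * x) + exp (- theta * x)).
Proof.
move=> theta_ge0; rewrite /lt_indicator Rmult_plus_distr_l -!exp_plus.
set y := - (theta * u) + theta * x; set z := - (theta * u) + - theta * x.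
have y_gt0 := exp_pos y; have z_gt0 := exp_pos z.
case: (Rlt_dec u (Rabs x)) => [lt_ux|?] /=; last by lra.
move: lt_ux; rewrite /Rabs; case: (Rcase_abs x) => ? lt_ux.
  by have := exp_ineq1_le z; rewrite /z in z_gt0 *; nra.
by have := exp_ineq1_le y; rewrite /y in y_gt0 *; nra.
Qed.

Section Rademacher.
Variable L : finType.
Implicit Types (a : L -> R) (s : {ffun L -> bool}).

Definition rademacher a s : R := \sum_l sgn (s l) * a l.

Lemma rademacher_eq0 a s : \sum_l a l ^ 2 <= 0 -> rademacher a s = 0.
Proof. by move/sum_sqr_eq0=> a0; apply: big1 => l _; rewrite a0 Rmult_0_r. Qed.

Lemma sum_exp_rademacher a :
  \sum_(s : {ffun L -> bool}) exp (rademacher a s) = \prod_l (2 * cosh (a l)).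
Proof.
rewrite (eq_bigr (fun s : {ffun L -> bool} => \prod_l exp (sgn (s l) * a l))) => [|s _].
  rewrite -(bigA_distr_bigA (fun l b => exp (sgn b * a l))).
  apply: eq_bigr => l _; rewrite big_bool /cosh /= Rmult_1_l.
  by rewrite (_ : -1 * a l = - a l); [field|ring].
exact: exp_sum.
Qed.

Lemma rademacher_mgf_le a (V theta : R) : \sum_l a l ^ 2 <= V ->
  \sum_(s : {ffun L -> bool}) exp (theta * rademacher a s)
  <= 2 ^ #|L| * exp (theta ^ 2 * V / 2).
Proof.
move=> a_le_V.
rewrite (eq_bigr (fun s => exp (rademacher (fun l => theta * a l) s))) => [|s _]; last first.
  by congr exp; rewrite /rademacher big_distrr; apply: eq_bigr => l _ /=; ring.
rewrite sum_exp_rademacher.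
apply: (Rle_trans _ (\prod_l (2 * exp ((theta * a l) ^ 2 / 2)))).
  apply: Rprod_le => l _; have := cosh_le_exp_half_sqr (theta * a l).
  by have := exp_pos (theta * a l); have := exp_pos (- (theta * a l)); rewrite /cosh; lra.
rewrite big_split /= Rprod_const -exp_sum.
apply: Rmult_le_compat_l; first by apply: pow_le; lra.
apply: exp_le; rewrite (eq_bigr (fun l => theta ^ 2 / 2 * a l ^ 2)) => [|l _]; last by field.
by rewrite -big_distrr /=; have := Rmult_le_compat_l _ _ _ (pow2_ge_0 theta) a_le_V; lra.
Qed.

Lemma hoeffding a (V u : R) : 0 < V -> 0 <= u -> \sum_l a l ^ 2 <= V ->
  \sum_(s : {ffun L -> bool}) lt_indicator u (Rabs (rademacher a s))
  <= 2 ^ #|L| * (2 * exp (- (u ^ 2 / (2 * V)))).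
Proof.
move=> V_gt0 u_ge0 a_le_V; pose theta := u / V.
have theta_ge0 : 0 <= theta by apply: Rdiv_le_0_compat.
have mgf_le := rademacher_mgf_le theta a_le_V.
have := rademacher_mgf_le (- theta) a_le_V.
rewrite -(_ : theta ^ 2 = (- theta) ^ 2) => [mgf_opp_le|]; last by ring.
have chernoff : exp (- (theta * u)) * exp (theta ^ 2 * V / 2) = exp (- (u ^ 2 / (2 * V))).
  by rewrite -exp_plus /theta; congr exp; field; lra.
set M := 2 ^ #|L| * exp (theta ^ 2 * V / 2) in mgf_le mgf_opp_le.
apply: (Rle_trans _ (\sum_(s : {ffun L -> bool}) exp (- (theta * u))
  * (exp (theta * rademacher a s) + exp (- theta * rademacher a s)))).
  by apply: Rsum_le => s _; apply: lt_indicator_abs_le_exp.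
apply: (Rle_trans _ (exp (- (theta * u)) * (M + M))); last first.
  by rewrite -chernoff /M; apply: Req_le; ring.
rewrite -big_distrr big_split; apply: Rmult_le_compat_l; last exact: Rplus_le_compat.
exact/Rlt_le/exp_pos.
Qed.

Lemma card_signs : INR #|{ffun L -> bool}| = 2 ^ #|L|.
Proof.
by rewrite card_ffun card_bool; elim: #|L| => //= n IHn; rewrite expnS mult_INR IHn.
Qed.

Lemma sum_sgn_mul (l m : L) :
  \sum_(s : {ffun L -> bool}) (sgn (s l) * sgn (s m)) = if l == m then 2 ^ #|L| else 0.
Proof.
case: eqP => [->|/eqP neq_lm].
  rewrite (eq_bigr (fun=> 1)) => [|s _]; last by case: (s m) => /=; ring.
  by rewrite Rsum_const -card_signs Rmult_1_r.
pose flip (s : {ffun L -> bool}) := [ffun k => if k == l then ~~ s k else s k].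
have flipK : involutive flip.
  by move=> s; apply/ffunP => k; rewrite !ffunE; case: (k == l); rewrite ?negbK.
set S := \sum_s _; suff : S = - 1 * S by lra.
rewrite {1}/S (reindex_inj (inv_inj flipK)) big_distrr /=.
apply: eq_bigr => s _; rewrite !ffunE eqxx eq_sym (negbTE neq_lm).
by case: (s l) => /=; ring.
Qed.

Lemma rademacher_second_moment a :
  \sum_(s : {ffun L -> bool}) rademacher a s ^ 2 = 2 ^ #|L| * \sum_l a l ^ 2.
Proof.
transitivity (\sum_(s : {ffun L -> bool}) \sum_l \sum_m
   a l * a m * (sgn (s l) * sgn (s m))).
  apply: eq_bigr => s _; rewrite /rademacher -Rsqr_pow2 /Rsqr big_distrl.
  by apply: eq_bigr => l _; rewrite big_distrr; apply: eq_bigr => m _ /=; ring.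
rewrite exchange_big big_distrr; apply: eq_bigr => l _.
rewrite exchange_big (bigD1 l) //= [X in _ + X]big1 => [|m neq_ml].
  by rewrite -big_distrr /= sum_sgn_mul eqxx /=; ring.
by rewrite -big_distrr /= sum_sgn_mul eq_sym (negbTE neq_ml) Rmult_0_r.
Qed.

End Rademacher.

Section PermutationFibers.
Variables (T : finType) (o : T).

Definition perm_fiber (i : T) : pred {perm T} := [pred p : {perm T} | p i == o].

Lemma sum_perm_fibers (F : {perm T} -> R) :
  \sum_p F p = \sum_i \sum_(p in perm_fiber i) F p.
Proof.
rewrite (partition_big (fun p : {perm T} => (p^-1)%g o) predT) //=.
apply: eq_bigr => i _; apply: eq_bigl => p; rewrite inE.
by apply/eqP/eqP => <-; rewrite ?permKV ?permK.
Qed.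

Lemma card_perm_fiber (i j : T) : #|perm_fiber i| = #|perm_fiber j|.
Proof.
rewrite -!sum1_card (reindex_inj (mulgI (tperm i j))); apply: eq_bigl => p.
by rewrite !inE permM tpermL.
Qed.

Lemma perm_fiber_tperm (i : T) : tperm i o \in perm_fiber i.
Proof. by rewrite inE tpermL. Qed.

(* Composing with the transposition of [l] and [k] preserves the fiber and swaps the values
   at [l] and [k]. *)
Lemma sum_perm_fiber_off (i l : T) (f : T -> R) : l != i ->
  INR #|T|.-1 * \sum_(p in perm_fiber i) f (p l)
  = INR #|perm_fiber i| * \sum_(k | k != o) f k.
Proof.
move=> neq_li; rewrite -(cardC1 i) -!Rsum_const.
transitivity (\sum_(k | k != i) \sum_(p in perm_fiber i) f (p k)).
  apply: eq_bigr => k neq_ki; rewrite (reindex_inj (mulgI (tperm l k))).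
  by apply: eq_big => [p|p _]; rewrite ?inE permM ?tpermL ?tpermD // eq_sym.
rewrite exchange_big; apply: eq_bigr => p /eqP pi_o.
rewrite [RHS](reindex_inj (@perm_inj _ p)) -pi_o.
by apply: eq_bigl => k; rewrite (inj_eq perm_inj).
Qed.

Lemma sum_perm_fiber_dot (i : T) (f g : T -> R) :
  (1 < #|T|)%N -> \sum_l g l = 0 ->
  \sum_(p in perm_fiber i) \sum_l f (p l) * g l
  = INR #|perm_fiber i| * ((f o - (\sum_l f l - f o) / INR #|T|.-1) * g i).
Proof.
move=> T_gt1 g0; set N := INR #|perm_fiber i|; set n := INR #|T|.-1.
have n_gt0 : 0 < n by apply/lt_0_INR/ltP; rewrite -ltnS prednK // ltnW.
have split_at (j : T) (F : T -> R) : \sum_l F l = F j + \sum_(l | l != j) F l.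
  by rewrite (bigD1 j).
pose M l := \sum_(p in perm_fiber i) f (p l).
have M_on : M i = N * f o by rewrite -Rsum_const; apply: eq_bigr => p /eqP ->.
have M_off l : l != i -> M l = N * (\sum_(k | k != o) f k) / n.
  by move=> neq_li; rewrite -(sum_perm_fiber_off f neq_li) -/(M l) -/n; field; lra.
transitivity (\sum_l M l * g l).
  by rewrite exchange_big; apply: eq_bigr => l _; rewrite /M big_distrl.
rewrite (split_at i) M_on.
rewrite (eq_bigr (fun l => N * (\sum_(k | k != o) f k) / n * g l)) => [|l /M_off -> //].
rewrite -big_distrr /=; rewrite (split_at i) in g0.
by rewrite (split_at o) (_ : \sum_(l | l != i) g l = - g i); [field|]; lra.
Qed.

End PermutationFibers.

Section MaximumOfList.
Variables (T : eqType) (f : T -> R) (r : seq T).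

Lemma foldr_Rmax_ge0 : 0 <= foldr Rmax 0 [seq f x | x <- r].
Proof. by elim: r => [|x r' IHr] /=; [lra|apply: Rle_trans IHr _; apply: Rmax_r]. Qed.

Lemma foldr_Rmax_ge (x : T) : x \in r -> f x <= foldr Rmax 0 [seq f x | x <- r].
Proof.
elim: r => //= y r' IHr; rewrite inE => /orP[/eqP-> |/IHr le_fx]; first exact: Rmax_l.
by apply: Rle_trans le_fx _; apply: Rmax_r.
Qed.

Lemma foldr_Rmax_le (B : R) : 0 <= B -> (forall x, f x <= B) ->
  foldr Rmax 0 [seq f x | x <- r] <= B.
Proof. by move=> B_ge0 f_le; elim: r => //= x r'; apply: Rmax_lub. Qed.

Lemma foldr_Rmax_gt0 : 0 < foldr Rmax 0 [seq f x | x <- r] -> exists x, 0 < f x.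
Proof.
elim: r => /= [|x r' IHr]; first by lra.
by rewrite /Rmax; case: (Rle_dec (f x) _) => // _ fx_gt0; exists x.
Qed.

End MaximumOfList.

Lemma Rabs_le_sqr (x y : R) : Rabs x <= Rabs y -> x ^ 2 <= y ^ 2.
Proof. by rewrite -!Rsqr_pow2; apply: Rsqr_le_abs_1. Qed.

Lemma linf_sqr_ge (n : nat) (v : 'I_n -> R) (i : 'I_n) : v i ^ 2 <= linf v ^ 2.
Proof.
rewrite -(pow2_abs (v i)); apply: pow_incr; split; first exact: Rabs_pos.
by apply: (foldr_Rmax_ge (fun i => Rabs (v i))); rewrite mem_enum.
Qed.

Lemma linf_sqr_le (n : nat) (v : 'I_n -> R) (B : R) :
  0 <= B -> (forall i, v i ^ 2 <= B) -> linf v ^ 2 <= B.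
Proof.
move=> B_ge0 v_le; rewrite -(pow2_sqrt B B_ge0); apply: pow_incr; split.
  exact: foldr_Rmax_ge0.
apply: foldr_Rmax_le => [|i]; first exact: sqrt_pos.
by rewrite -sqrt_Rsqr_abs Rsqr_pow2; apply: sqrt_le_1_alt.
Qed.

Section Vectors.
Variable d : nat.
Implicit Types u v w : 'I_d -> R.

Lemma dotC u v : dot u v = dot v u.
Proof. by apply: eq_bigr => k _; ring. Qed.

Lemma dotBl u v w : dot (fun k => u k - v k) w = dot u w - dot v w.
Proof.
rewrite (_ : dot u w - dot v w = dot u w + -1 * dot v w); last by ring.
by rewrite /dot big_distrr -big_split; apply: eq_bigr => k _ /=; ring.
Qed.

Lemma dotZl (a : R) u w : dot (fun k => a * u k) w = a * dot u w.
Proof. by rewrite /dot big_distrr; apply: eq_bigr => k _ /=; ring. Qed.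

Lemma dot_self u : dot u u = \sum_k u k ^ 2.
Proof. by apply: eq_bigr => k _; ring. Qed.

Lemma dot_self_ge0 u : 0 <= dot u u.
Proof. by rewrite dot_self; apply: sum_sqr_ge0. Qed.

Lemma dot_self_eq0 u : dot u u <= 0 -> forall k, u k = 0.
Proof. by rewrite dot_self; apply: sum_sqr_eq0. Qed.

Lemma cauchy_schwarz u v : dot u v ^ 2 <= dot u u * dot v v.
Proof. by rewrite !dot_self; apply: cauchy_schwarz_sum. Qed.

Lemma norm2_sqr u : norm2 u ^ 2 = dot u u.
Proof. exact/pow2_sqrt/dot_self_ge0. Qed.

Lemma dot_unit u : norm2 u = 1 -> dot u u = 1.
Proof. by move=> u1; rewrite -norm2_sqr u1; ring. Qed.

Lemma dot_unit_pair u v : norm2 u = 1 -> norm2 v = 1 ->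
  dot u v = 1 - norm2 (fun k => u k - v k) ^ 2 / 2.
Proof.
move=> /dot_unit u1 /dot_unit v1.
suff -> : norm2 (fun k => u k - v k) ^ 2 = 2 - 2 * dot u v by field.
by rewrite norm2_sqr dotBl (dotC u) (dotC v) !dotBl u1 v1 (dotC v u); ring.
Qed.

Definition orth_part u v : 'I_d -> R := fun k => v k - dot v u * u k.

Lemma dot_orth_part u v w : dot (orth_part u v) w = dot v w - dot v u * dot u w.
Proof. by rewrite dotBl dotZl. Qed.

Lemma dot_orth_part_base u v : norm2 u = 1 -> dot (orth_part u v) u = 0.
Proof. by move=> /dot_unit u1; rewrite dot_orth_part u1; ring. Qed.

Lemma dot_orth_part_self u v : norm2 u = 1 -> norm2 v = 1 ->
  dot (orth_part u v) (orth_part u v) = 1 - dot v u ^ 2.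
Proof.
move=> u1 /dot_unit v1; rewrite dot_orth_part (dotC u) (dot_orth_part_base _ u1).
by rewrite dotC dot_orth_part v1 (dotC u); ring.
Qed.

Lemma Rabs_dot_le_add_orth_part u v w : Rabs (dot v u) <= 1 ->
  Rabs (dot v w) <= Rabs (dot u w) + Rabs (dot (orth_part u v) w).
Proof.
move=> vu_le1; have -> : dot v w = dot v u * dot u w + dot (orth_part u v) w.
  by rewrite dot_orth_part; ring.
have := Rabs_triang (dot v u * dot u w) (dot (orth_part u v) w); rewrite Rabs_mult.
by have := Rmult_le_compat_r _ _ _ (Rabs_pos (dot u w)) vu_le1; lra.
Qed.

Lemma Rabs_dot_ge_sub_orth_part u v w (beta : R) : beta <= Rabs (dot v u) ->
  beta * Rabs (dot u w) - Rabs (dot (orth_part u v) w) <= Rabs (dot v w).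
Proof.
move=> le_beta; have -> : dot v w = dot v u * dot u w - - dot (orth_part u v) w.
  by rewrite dot_orth_part; ring.
have := Rabs_triang_inv (dot v u * dot u w) (- dot (orth_part u v) w).
rewrite Rabs_mult Rabs_Ropp.
by have := Rmult_le_compat_r _ _ _ (Rabs_pos (dot u w)) le_beta; lra.
Qed.

End Vectors.

Section Dictionaries.
Variables d K : nat.
Implicit Types (Phi Psi : dict d K) (v : 'I_d -> R).

Lemma dot_synthesis Phi (x : 'I_K -> R) v :
  dot v (synthesis Phi x) = \sum_l x l * dot v (Phi l).
Proof.
transitivity (\sum_j \sum_l x l * (v j * Phi l j)).
  by apply: eq_bigr => j _; rewrite /synthesis big_distrr; apply: eq_bigr => l _ /=; ring.
by rewrite exchange_big; apply: eq_bigr => l _; rewrite -big_distrr.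
Qed.

Lemma untf_synthesis_le Phi (A : R) (x : 'I_K -> R) : is_untf Phi A -> 0 <= A ->
  dot (synthesis Phi x) (synthesis Phi x) <= A * \sum_l x l ^ 2.
Proof.
case=> _ frame A_ge0; set y := synthesis Phi x; set x2 := \sum_l x l ^ 2.
have yE : dot y y = \sum_l x l * dot (Phi l) y.
  by rewrite dot_synthesis; apply: eq_bigr => l _; rewrite dotC.
have : dot y y ^ 2 <= x2 * (A * dot y y).
  by rewrite -frame {1}yE; apply: cauchy_schwarz_sum.
case: (dot_self_ge0 y) => [y_gt0 y_le|<- _]; last exact/Rmult_le_pos/sum_sqr_ge0.
by apply: (Rmult_le_reg_l (dot y y)) => //; lra.
Qed.

Lemma untf_const_ge1 Phi (A : R) (i : 'I_K) : is_untf Phi A -> 1 <= A.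
Proof.
case=> /(_ i)/dot_unit unit_i /(_ (Phi i)); rewrite unit_i Rmult_1_r => <-.
have := @Rsum_ge_term _ (fun l => dot (Phi l) (Phi i) ^ 2) i (fun l => pow2_ge_0 _).
by rewrite unit_i pow1.
Qed.

Lemma coherence_ge0 Phi : 0 <= coherence Phi.
Proof. exact: foldr_Rmax_ge0. Qed.

Lemma coherence_ge Phi (i j : 'I_K) : i != j -> Rabs (dot (Phi i) (Phi j)) <= coherence Phi.
Proof.
move=> neq_ij; apply: (foldr_Rmax_ge
  (fun ij : 'I_K * 'I_K => Rabs (dot (Phi ij.1) (Phi ij.2))) (x := (i, j))).
by rewrite mem_enum.
Qed.

Lemma dict_dist_ge Psi Phi (i : 'I_K) : norm2 (fun k => Psi i k - Phi i k) <= dict_dist Psi Phi.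
Proof.
by apply: (foldr_Rmax_ge (fun i => norm2 (fun k => Psi i k - Phi i k))); rewrite mem_enum.
Qed.

Lemma dict_dist_eq0 Psi Phi : dict_dist Psi Phi <= 0 -> Psi = Phi.
Proof.
move=> dist_le0; apply: functional_extensionality => i; apply: functional_extensionality => k.
suff : Psi i k - Phi i k = 0 by lra.
apply: (@dot_self_eq0 _ (fun k => Psi i k - Phi i k)); rewrite -norm2_sqr.
rewrite (_ : norm2 _ = 0); first by rewrite pow_i; [lra|lia].
by apply: Rle_antisym; [exact: Rle_trans (dict_dist_ge _ _ _) dist_le0|exact: sqrt_pos].
Qed.

Lemma local_max_of_strict_max (F : dict d K -> R) Phi (r : R) : 0 < r ->
  (forall Psi, in_D Psi -> 0 < dict_dist Psi Phi -> dict_dist Psi Phi <= r -> F Psi < F Phi) ->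
  local_max_on_D F Phi.
Proof.
move=> r_gt0 F_lt; exists r; split=> // Psi unit_Psi /Rlt_le dist_le.
case: (Rle_lt_dec (dict_dist Psi Phi) 0) => [/dict_dist_eq0-> |dist_gt0].
  exact: Rle_refl.
exact/Rlt_le/F_lt.
Qed.

End Dictionaries.

Section SignedMixtures.
Variables (d K : nat) (Phi : dict d K) (c : nat -> R) (p : {perm 'I_K}).
Implicit Types (s : {ffun 'I_K -> bool}) (u v : 'I_d -> R).

Definition mixture s : 'I_d -> R := synthesis Phi (cps c p s).

Definition correlation_energy v : R := \sum_l (c (p l) * dot v (Phi l)) ^ 2.

Lemma dot_mixture s v :
  dot v (mixture s) = rademacher (fun l => c (p l) * dot v (Phi l)) s.
Proof. by rewrite /mixture dot_synthesis; apply: eq_bigr => l _; exact: Rmult_assoc. Qed.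

Lemma sum_dot_mixture_sqr v :
  \sum_(s : {ffun 'I_K -> bool}) dot v (mixture s) ^ 2 = 2 ^ K * correlation_energy v.
Proof.
under eq_bigr do rewrite dot_mixture.
by rewrite rademacher_second_moment card_ord.
Qed.

Lemma correlation_energyB u v :
  correlation_energy u - correlation_energy v
  = \sum_l c (p l) ^ 2 * (dot u (Phi l) ^ 2 - dot v (Phi l) ^ 2).
Proof.
apply: (Rplus_eq_reg_r (correlation_energy v)).
rewrite /correlation_energy Rplus_assoc Rplus_opp_l Rplus_0_r -big_split.
by apply: eq_bigr => l _ /=; ring.
Qed.

Lemma dot_mixture_tail v (b t w : R) : 0 <= b -> 0 <= t -> 0 < w ->
  correlation_energy v <= b ^ 2 * w ->
  \sum_(s : {ffun 'I_K -> bool}) lt_indicator (b * t) (Rabs (dot v (mixture s)))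
  <= 2 ^ K * (2 * exp (- (t ^ 2 / (2 * w)))).
Proof.
move=> b_ge0 t_ge0 w_gt0 energy_le.
under eq_bigr do rewrite dot_mixture.
case: b_ge0 => [b_gt0|b0]; last first.
  rewrite big1 => [|s _]; last first.
    rewrite rademacher_eq0 ?Rabs_R0 -?b0 ?Rmult_0_l.
      by rewrite /lt_indicator; case: (Rlt_dec 0 0) => ? /=; lra.
    by move: energy_le; rewrite /correlation_energy -b0; lra.
  have := exp_pos (- (t ^ 2 / (2 * w))); have := pow_lt 2 K ltac:(lra).
  by move=> *; apply: Rmult_le_pos; lra.
have bw_gt0 : 0 < b ^ 2 * w by apply: Rmult_lt_0_compat => //; apply: pow_lt.
have := hoeffding bw_gt0 (Rmult_le_pos _ _ (Rlt_le _ _ b_gt0) t_ge0) energy_le.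
by rewrite card_ord (_ : (b * t) ^ 2 / (2 * (b ^ 2 * w)) = t ^ 2 / (2 * w)) //; field; lra.
Qed.

Lemma correlation_energy_le (A b : R) v : is_untf Phi A ->
  (forall l, 0 <= c (p l) <= b \/ dot v (Phi l) = 0) ->
  correlation_energy v <= b ^ 2 * (A * dot v v).
Proof.
case=> _ <- c_le; rewrite big_distrr; apply: Rsum_le => l _ /=.
rewrite Rpow_mult_distr (dotC (Phi l)).
case: (c_le l) => [c_bd|->]; last by rewrite pow_i; [lra|lia].
by apply: Rmult_le_compat_r; [exact: pow2_ge_0|exact: pow_incr].
Qed.

Lemma mixture_energy_le (A : R) s : is_untf Phi A -> 0 <= A ->
  dot (mixture s) (mixture s) <= A * \sum_(l < K) c l ^ 2.
Proof.
move=> frame A_ge0; apply: Rle_trans (untf_synthesis_le _ frame A_ge0) _.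
rewrite [X in _ <= _ * X](reindex_inj (@perm_inj _ p)) /=.
apply/Req_le/f_equal/eq_bigr => l _.
by rewrite /cps; case: (s l) => /=; ring.
Qed.

Definition interference : R := coherence Phi * \sum_(l < K) Rabs (c l).

Lemma interference_ge0 : 0 <= interference.
Proof.
apply: Rmult_le_pos; first exact: coherence_ge0.
by apply: Rsum_ge0 => l _; apply: Rabs_pos.
Qed.

Lemma Rabs_sgn_mul (b : bool) (x : R) : Rabs (sgn b * x) = Rabs x.
Proof. by rewrite Rabs_mult; case: b => /=; rewrite ?Rabs_Ropp Rabs_R1; ring. Qed.

Lemma dot_atom_mixture (j : 'I_K) s : in_D Phi ->
  Rabs (dot (Phi j) (mixture s) - sgn (s j) * c (p j)) <= interference.
Proof.
move=> unit_Phi; rewrite dot_synthesis (bigD1 j) //= (dot_unit (unit_Phi j)) Rmult_1_r.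
rewrite {1}/cps Rplus_minus_l; apply: Rle_trans (Rabs_sum_le _ _ _) _.
rewrite /interference [X in _ <= _ * X](reindex_inj (@perm_inj _ p)) big_distrr.
rewrite [X in _ <= X](bigD1 j) //=.
rewrite -[X in X <= _]Rplus_0_l; apply: Rplus_le_compat.
  by apply: Rmult_le_pos; [exact: coherence_ge0|exact: Rabs_pos].
apply: Rsum_le => l neq_lj; rewrite Rabs_mult Rabs_sgn_mul Rmult_comm.
by apply: Rmult_le_compat_r; [exact: Rabs_pos|apply: coherence_ge; rewrite eq_sym].
Qed.

Lemma Rabs_dot_atom_mixture (j : 'I_K) s : in_D Phi -> 0 <= c (p j) ->
  c (p j) - interference <= Rabs (dot (Phi j) (mixture s)) <= c (p j) + interference.
Proof.
move=> unit_Phi c_ge0; have := dot_atom_mixture j s unit_Phi.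
have := Rabs_triang_inv2 (dot (Phi j) (mixture s)) (sgn (s j) * c (p j)).
rewrite Rabs_sgn_mul (Rabs_pos_eq _ c_ge0).
move=> reverse_triangle near_coeff.
by have /Rabs_le_between := Rle_trans _ _ _ reverse_triangle near_coeff; lra.
Qed.

End SignedMixtures.

Lemma sum_perm_fiber_energy_gain (d K : nat) (Phi : dict d K) (A : R) (c : nat -> R)
    (o i : 'I_K) (v : 'I_d -> R) :
  (1 < K)%N -> is_untf Phi A -> norm2 v = 1 ->
  \sum_(p in perm_fiber o i)
     (correlation_energy Phi c p (Phi i) - correlation_energy Phi c p v)
  = INR #|perm_fiber o i|
    * ((c o ^ 2 - (\sum_(l < K) c l ^ 2 - c o ^ 2) / INR K.-1) * (1 - dot v (Phi i) ^ 2)).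
Proof.
move=> K_gt1 [unit_Phi frame] unit_v; pose g l := dot (Phi i) (Phi l) ^ 2 - dot v (Phi l) ^ 2.
have g_sum0 : \sum_l g l = 0.
  have unit_energy u : norm2 u = 1 -> \sum_l dot u (Phi l) ^ 2 = A.
    move=> /dot_unit u1; rewrite -[RHS]Rmult_1_r -u1 -frame.
    by apply: eq_bigr => l _; rewrite dotC.
  have : \sum_l g l + \sum_l dot v (Phi l) ^ 2 = \sum_l dot (Phi i) (Phi l) ^ 2.
    by rewrite -big_split; apply: eq_bigr => l _; rewrite /g /=; ring.
  by rewrite !unit_energy //; lra.
have -> : 1 - dot v (Phi i) ^ 2 = g i by rewrite /g (dot_unit (unit_Phi i)) pow1.
have := @sum_perm_fiber_dot _ o i (fun l => c l ^ 2) g _ g_sum0.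
rewrite card_ord => <- //.
by apply: eq_bigr => p _; apply: correlation_energyB.
Qed.

Lemma sqr_lt_exp (v : R) : 5 <= v -> v ^ 2 < exp (93 / 100 * v - 1).
Proof.
move=> v_ge5; pose x := 93 / 200 * v - / 2.
have x_ge : 73 / 40 <= x by rewrite /x; lra.
have taylor : 1 + x + x ^ 2 / 2 + x ^ 3 / 6 <= exp x.
  by have := @exp_ge_taylor x 3 ltac:(lra); rewrite /sum_f_R0 /=; lra.
have x2_ge : 73 / 40 * x <= x ^ 2 by nra.
have x3_ge : 73 / 40 * (73 / 40 * x) <= x ^ 3 by nra.
have v_lt : v < exp x by rewrite /x in x2_ge x3_ge taylor *; lra.
rewrite (_ : 93 / 100 * v - 1 = x + x); last by rewrite /x; field.
by rewrite exp_plus -Rsqr_pow2 /Rsqr; apply: Rmult_gt_0_lt_compat; lra.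
Qed.

Lemma half_sqr_le_thirtieth (eps delta : R) : 0 < eps -> eps < / 5 -> 0 < delta ->
  2 * eps <= delta ^ 2 -> eps ^ 2 / 2 <= delta / 30.
Proof.
move=> eps_gt0 eps_lt delta_gt0 eps_le.
apply: Rsqr_incr_0_var; last by lra.
have eps2_le : eps ^ 2 <= / 25 by nra.
have eps3_le : eps ^ 3 <= / 125 by nra.
have : eps ^ 3 * eps <= / 125 * eps by apply: Rmult_le_compat_r; lra.
by rewrite /Rsqr; lra.
Qed.

(* With [v = 1 / sqrt w >= 5], the exponent on the left is at least [93/100 L v], while the
   right hand side is [exp (- L - 2 ln v)]. *)
Lemma gaussian_tail_lt (A L eps delta w : R) :
  1 <= A -> 1 <= L -> 0 < eps -> eps < / 5 -> 0 < delta ->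
  2 * A * L * eps <= delta ^ 2 -> 0 < w -> w <= eps ^ 2 ->
  exp (- ((delta - eps ^ 2 / 2) ^ 2 / (2 * (A * w)))) < exp (- L) * w.
Proof.
move=> A_ge1 L_ge1 eps_gt0 eps_lt delta_gt0 eps_mul_le w_gt0 w_le.
have AL_ge1 : 1 <= A * L by nra.
have half_sqr_le : eps ^ 2 / 2 <= delta / 30 by apply: half_sqr_le_thirtieth => //; nra.
set t := delta - eps ^ 2 / 2.
have t2_ge : 93 / 100 * delta ^ 2 <= t ^ 2.
  have := pow_incr (29 / 30 * delta) t 2 ltac:(rewrite /t; lra).
  by rewrite Rpow_mult_distr; have := pow2_ge_0 delta; lra.
have [r r_gt0 r_sqr] : exists2 r, 0 < r & r ^ 2 = w.
  by exists (sqrt w); [exact: sqrt_lt_R0|apply: pow2_sqrt; lra].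
have r_le : r <= eps by apply: Rsqr_incr_0_var; rewrite ?Rsqr_pow2; lra.
have v_ge5 : 5 <= / r by rewrite -(Rinv_inv 5); apply: Rinv_le_contravar; lra.
have exponent_ge : 93 / 100 * L * / r <= t ^ 2 / (2 * (A * w)).
  have den_gt0 : 0 < 2 * (A * w) by apply: Rmult_lt_0_compat; [|apply: Rmult_lt_0_compat]; lra.
  apply/(Rle_div_r _ _ _ den_gt0); apply: Rle_trans t2_ge.
  rewrite -r_sqr (_ : _ * _ = 93 / 100 * (2 * A * L * r)); last by field; lra.
  apply: Rmult_le_compat_l; first lra.
  by apply: Rle_trans eps_mul_le; apply: Rmult_le_compat_l; lra.
have := sqr_lt_exp v_ge5; rewrite pow_inv r_sqr => sqr_lt.
apply: (Rle_lt_trans _ (exp (- L) * exp (- (93 / 100 * / r - 1)))).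
  by rewrite -exp_plus; apply: exp_le; nra.
apply: Rmult_lt_compat_l; first exact: exp_pos.
rewrite exp_Ropp -[w in _ < w]Rinv_inv; apply: Rinv_lt_contravar => //.
by apply: Rmult_lt_0_compat; [exact: Rinv_0_lt_compat|exact: exp_pos].
Qed.

Definition margin (d K : nat) (Phi : dict d K) (c : nat -> R) : R :=
  1 - 2 * ((c 1%N + interference Phi c) / (c 1%N + c 0%N)).

Definition peak_excess (K : nat) (c : nat -> R) : R :=
  c 0%N ^ 2 - (1 - c 0%N ^ 2) / (INR K - 1).

Definition log_factor (K : nat) (A : R) (c : nat -> R) : R :=
  ln (2 * A * INR K / peak_excess K c).

Definition attraction_radius (d K : nat) (Phi : dict d K) (A : R) (c : nat -> R) : R :=
  margin Phi c ^ 2 / (2 * A * log_factor K A c).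

Section GappedCoefficients.
Variables (d K : nat) (Phi : dict d K) (A : R) (c : nat -> R).
Hypotheses (K_gt1 : (1 < K)%N) (frame : is_untf Phi A).
Hypothesis c_nonincreasing : forall i j : nat, (i <= j)%N -> (j < K)%N -> c j <= c i.
Hypothesis c_ge0 : forall i : nat, (i < K)%N -> 0 <= c i.
Hypothesis c_norm : \sum_(i < K) c i ^ 2 = 1.
Hypothesis c_gap : c 1%N + 2 * interference Phi c < c 0%N.

Lemma INR_K_gt1 : 1 < INR K.
Proof. exact/(lt_INR 1)/ltP. Qed.

Lemma frame_const_ge1 : 1 <= A.
Proof. exact: (untf_const_ge1 (Ordinal K_gt1) frame). Qed.

Lemma c1_lt_c0 : c 1%N < c 0%N.
Proof. by have := interference_ge0 Phi c; lra. Qed.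

Lemma margin_mulE :
  (c 1%N + c 0%N) * margin Phi c = c 0%N - c 1%N - 2 * interference Phi c.
Proof. by rewrite /margin; field; have := c1_lt_c0; have := c_ge0 K_gt1; lra. Qed.

Lemma margin_gt0 : 0 < margin Phi c.
Proof.
have := c1_lt_c0; have := c_ge0 K_gt1 => c1_ge0 c1_lt.
by apply: (Rmult_lt_reg_l (c 1%N + c 0%N)); rewrite ?margin_mulE; lra.
Qed.

Lemma peak_excess_bounds : 0 < peak_excess K c <= 1.
Proof.
have K_gt1R := INR_K_gt1; have c1_ge0 := c_ge0 K_gt1; have c1_lt := c1_lt_c0.
have c0_sqr_le1 : c 0%N ^ 2 <= 1.
  rewrite -c_norm.
  exact: (Rsum_ge_term (Ordinal (ltnW K_gt1)) (fun i => pow2_ge_0 (c (nat_of_ord i)))).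
have c0_sqr_gt : 1 < INR K * c 0%N ^ 2.
  rewrite -[X in X < _]c_norm -[K in INR K]card_ord -Rsum_const.
  apply: (Rsum_lt (Ordinal K_gt1)) => // [i _|] /=; last by nra.
  by apply: pow_incr; split; [exact: c_ge0|exact: c_nonincreasing].
have -> : peak_excess K c = (INR K * c 0%N ^ 2 - 1) / (INR K - 1).
  by rewrite /peak_excess; field; lra.
have den_gt0 : 0 < INR K - 1 by lra.
by split; [apply: Rdiv_lt_0_compat; lra|apply/(Rle_div_l _ _ _ den_gt0); nra].
Qed.

Lemma log_argument_ge4 : 4 <= 2 * A * INR K / peak_excess K c.
Proof.
have [excess_gt0 excess_le1] := peak_excess_bounds; have A_ge1 := frame_const_ge1.
have K_ge2 : 2 <= INR K by apply/(le_INR 2)/leP.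
have AK_ge : 1 * 2 <= A * INR K by apply: Rmult_le_compat; lra.
by apply/(Rle_div_r _ _ _ excess_gt0); lra.
Qed.

Lemma log_factor_ge1 : 1 <= log_factor K A c.
Proof.
rewrite -[X in X <= _](ln_exp 1); apply/Rlt_le/ln_increasing; first exact: exp_pos.
by have := exp_le_3; have := log_argument_ge4; lra.
Qed.

Lemma exp_opp_log_factor : exp (- log_factor K A c) = peak_excess K c / (2 * A * INR K).
Proof.
have := peak_excess_bounds; have := frame_const_ge1; have := INR_K_gt1; have := log_argument_ge4.
by move=> *; rewrite exp_Ropp exp_ln; [field|]; lra.
Qed.

Lemma attraction_radius_gt0 : 0 < attraction_radius Phi A c.
Proof.
apply: Rdiv_lt_0_compat; first exact/pow_lt/margin_gt0.
by have := frame_const_ge1; have := log_factor_ge1; nra.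
Qed.

Let unit_Phi : in_D Phi.
Proof. exact: (proj1 frame). Qed.

Local Notation o := (Ordinal (ltnW K_gt1)).

Lemma coeff_bounds (p : {perm 'I_K}) (l : 'I_K) : 0 <= c (p l) <= c 0%N.
Proof. by split; [exact: c_ge0|exact: c_nonincreasing]. Qed.

Lemma coeff_off_peak_le (p : {perm 'I_K}) (i l : 'I_K) :
  p \in perm_fiber o i -> l != i -> c (p l) <= c 1%N.
Proof.
move=> /eqP pi neq_li; apply: c_nonincreasing => //; rewrite lt0n.
by apply: contra neq_li => /eqP pl0; apply/eqP/(@perm_inj _ p); rewrite pi; apply: val_inj.
Qed.

Section Perturbation.
Variables (Psi : dict d K) (eps : R).
Hypotheses (unit_Psi : in_D Psi) (eps_lt : eps < / 5).
Hypothesis eps_le : eps <= attraction_radius Phi A c.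
Hypotheses (dist_gt0 : 0 < dict_dist Psi Phi) (dist_le : dict_dist Psi Phi <= eps).

Local Notation tilt j := (orth_part (Phi j) (Psi j)).
Local Notation tilt_sqr j := (dot (orth_part (Phi j) (Psi j)) (orth_part (Phi j) (Psi j))).
Local Notation threshold := (margin Phi c - eps ^ 2 / 2).

Lemma eps_gt0 : 0 < eps.
Proof. exact: Rlt_le_trans dist_gt0 dist_le. Qed.

Lemma eps_sqr_le : eps ^ 2 <= / 25.
Proof. by have := eps_gt0; nra. Qed.

Lemma eps_mul_le : 2 * A * log_factor K A c * eps <= margin Phi c ^ 2.
Proof.
rewrite Rmult_comm; apply/Rle_div_r => //.
by have := frame_const_ge1; have := log_factor_ge1; nra.
Qed.

Lemma dot_atom_bounds (j : 'I_K) : 1 - eps ^ 2 / 2 <= dot (Psi j) (Phi j) <= 1.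
Proof.
rewrite (dot_unit_pair (unit_Psi j) (unit_Phi j)).
have := Rle_trans _ _ _ (dict_dist_ge Psi Phi j) dist_le; set e := norm2 _ => e_le.
have := pow2_ge_0 e; have := pow_incr e eps 2 (conj (sqrt_pos _) e_le).
by lra.
Qed.

Lemma tilt_sqrE (j : 'I_K) : tilt_sqr j = 1 - dot (Psi j) (Phi j) ^ 2.
Proof. exact: dot_orth_part_self. Qed.

Lemma tilt_sqr_le (j : 'I_K) : tilt_sqr j <= eps ^ 2.
Proof. by rewrite tilt_sqrE; have := dot_atom_bounds j; have := eps_gt0; nra. Qed.

Lemma exists_tilt_sqr_gt0 : exists j, 0 < tilt_sqr j.
Proof.
have [j dist_j_gt0] := foldr_Rmax_gt0 dist_gt0; exists j.
have := dot_atom_bounds j; have := eps_sqr_le; rewrite tilt_sqrE.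
rewrite (dot_unit_pair (unit_Psi j) (unit_Phi j)).
have := pow_lt _ 2 dist_j_gt0; set x := norm2 _ ^ 2 => x_gt0 eps2_le dot_bd.
rewrite (_ : 1 - _ = x * (1 - x / 4)); last by field.
by apply: Rmult_lt_0_compat; lra.
Qed.

Lemma threshold_ge0 : 0 <= threshold.
Proof.
have AL_ge1 : 1 <= A * log_factor K A c.
  by have := frame_const_ge1; have := log_factor_ge1; nra.
have := half_sqr_le_thirtieth eps_gt0 eps_lt margin_gt0.
by have := margin_gt0; have := eps_gt0; have := eps_mul_le; nra.
Qed.

(* The peak coefficient [c 0] does not reach [tilt i], which is orthogonal to [Phi i]. *)
Definition noise_level (i j : 'I_K) : R := if j == i then c 1%N else c 0%N.

Lemma noise_level_ge0 (i j : 'I_K) : 0 <= noise_level i j.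
Proof. by rewrite /noise_level; case: ifP => _; apply: c_ge0 => //; exact: ltnW. Qed.

Definition noisy (p : {perm 'I_K}) (i j : 'I_K) (s : {ffun 'I_K -> bool}) : R :=
  lt_indicator (noise_level i j * threshold) (Rabs (dot (tilt j) (mixture Phi c p s))).

Lemma tilt_energy_le (p : {perm 'I_K}) (i j : 'I_K) : p \in perm_fiber o i ->
  correlation_energy Phi c p (tilt j) <= noise_level i j ^ 2 * (A * tilt_sqr j).
Proof.
move=> p_fib; apply: correlation_energy_le => // l; have := coeff_bounds p l.
rewrite /noise_level; case: (eqVneq j i) => [->|_]; last by left.
case: (eqVneq l i) => [-> _|neq_li [cl_ge0 _]].
  by right; apply: dot_orth_part_base.
by left; split=> //; apply: coeff_off_peak_le p_fib neq_li.
Qed.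

Lemma sum_noisy_lt (p : {perm 'I_K}) (i j : 'I_K) : p \in perm_fiber o i -> 0 < tilt_sqr j ->
  \sum_(s : {ffun 'I_K -> bool}) noisy p i j s
  < 2 ^ K * (peak_excess K c / (A * INR K) * tilt_sqr j).
Proof.
move=> p_fib tilt_gt0; have A_ge1 := frame_const_ge1; have K_gt1R := INR_K_gt1.
have w_gt0 : 0 < A * tilt_sqr j by apply: Rmult_lt_0_compat; lra.
apply: Rle_lt_trans (dot_mixture_tail (noise_level_ge0 i j) threshold_ge0 w_gt0
  (tilt_energy_le j p_fib)) _.
apply: Rmult_lt_compat_l; first by apply: pow_lt; lra.
have := gaussian_tail_lt A_ge1 log_factor_ge1 eps_gt0 eps_lt margin_gt0 eps_mul_le tilt_gt0
  (tilt_sqr_le j).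
rewrite exp_opp_log_factor.
rewrite (_ : _ / (A * INR K) = 2 * (peak_excess K c / (2 * A * INR K))); last by field; lra.
by lra.
Qed.

Lemma sum_noisy_le (p : {perm 'I_K}) (i j : 'I_K) : p \in perm_fiber o i ->
  \sum_(s : {ffun 'I_K -> bool}) noisy p i j s
  <= 2 ^ K * (peak_excess K c / (A * INR K) * tilt_sqr j).
Proof.
move=> p_fib; case: (dot_self_ge0 (tilt j)) => [tilt_gt0|tilt0].
  exact/Rlt_le/sum_noisy_lt.
rewrite -tilt0 !Rmult_0_r; apply/Req_le/big1 => s _.
have dot0 : dot (tilt j) (mixture Phi c p s) = 0.
  have := cauchy_schwarz (tilt j) (mixture Phi c p s); rewrite -tilt0 Rmult_0_l => dot_sqr_le0.
  by apply: Rsqr_0_uniq; rewrite Rsqr_pow2; apply: Rle_antisym => //; apply: pow2_ge_0.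
rewrite /noisy dot0 Rabs_R0.
have := Rmult_le_pos _ _ (noise_level_ge0 i j) threshold_ge0.
by rewrite /lt_indicator; case: (Rlt_dec _ 0) => ? /=; lra.
Qed.

Lemma peak_atom_dominates (p : {perm 'I_K}) (i j : 'I_K) s : p \in perm_fiber o i ->
  (forall l, noisy p i l s < 1) ->
  dot (Psi j) (mixture Phi c p s) ^ 2 <= dot (Psi i) (mixture Phi c p s) ^ 2.
Proof.
move=> p_fib quiet; case: (eqVneq j i) => [->|neq_ji]; first exact: Rle_refl.
have tilt_le l := proj1 (lt_indicator_lt1 _ _) (quiet l).
have := tilt_le i; have := tilt_le j.
rewrite /noise_level eqxx (negbTE neq_ji) => tilt_j tilt_i.
have peak_coeff : c (p i) = c 0%N by rewrite (eqP p_fib).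
have [_ atom_j] := Rabs_dot_atom_mixture s unit_Phi (proj1 (coeff_bounds p j)).
have [atom_i _] := Rabs_dot_atom_mixture s unit_Phi (proj1 (coeff_bounds p i)).
have := dot_atom_bounds i; have := dot_atom_bounds j => alignment_j alignment_i.
have eps2_le := eps_sqr_le.
have upper : Rabs (dot (Psi j) (mixture Phi c p s))
    <= c 1%N + interference Phi c + c 0%N * threshold.
  have := @Rabs_dot_le_add_orth_part _ (Phi j) (Psi j) (mixture Phi c p s)
    ltac:(rewrite Rabs_pos_eq; lra).
  by have := coeff_off_peak_le p_fib neq_ji; lra.
have lower : (1 - eps ^ 2 / 2) * (c 0%N - interference Phi c) - c 1%N * threshold
    <= Rabs (dot (Psi i) (mixture Phi c p s)).
  have := @Rabs_dot_ge_sub_orth_part _ (Phi i) (Psi i) (mixture Phi c p s) (1 - eps ^ 2 / 2)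
    ltac:(rewrite Rabs_pos_eq; lra).
  have : (1 - eps ^ 2 / 2) * (c 0%N - interference Phi c)
      <= (1 - eps ^ 2 / 2) * Rabs (dot (Phi i) (mixture Phi c p s)).
    by apply: Rmult_le_compat_l; lra.
  by lra.
apply: Rabs_le_sqr; apply: Rle_trans upper _; apply: Rle_trans lower.
have : 0 <= eps ^ 2 / 2 * (c 1%N + interference Phi c).
  apply: Rmult_le_pos; first by have := pow2_ge_0 eps; lra.
  by have := interference_ge0 Phi c; have := c_ge0 K_gt1; lra.
by have := margin_mulE; lra.
Qed.

Lemma linf_analysis_le (p : {perm 'I_K}) (i : 'I_K) s : p \in perm_fiber o i ->
  linf (analysis Psi (mixture Phi c p s)) ^ 2
  <= dot (Psi i) (mixture Phi c p s) ^ 2 + A * \sum_(j < K) noisy p i j s.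
Proof.
move=> p_fib; set y := mixture Phi c p s; have A_ge1 := frame_const_ge1.
have noisy_ge0 j : 0 <= noisy p i j s by apply: lt_indicator_ge0.
have sum_ge0 : 0 <= \sum_(j < K) noisy p i j s by apply: Rsum_ge0.
have Asum_ge0 : 0 <= A * \sum_(j < K) noisy p i j s by apply: Rmult_le_pos; lra.
have peak_ge0 := pow2_ge_0 (dot (Psi i) y).
apply: linf_sqr_le => [|j]; first by lra.
case: (Rlt_le_dec (\sum_(j < K) noisy p i j s) 1) => [quiet|noise].
  suff : dot (Psi j) y ^ 2 <= dot (Psi i) y ^ 2 by rewrite /analysis; lra.
  apply: peak_atom_dominates => // l.
  exact: Rle_lt_trans (Rsum_ge_term l noisy_ge0) quiet.
have := cauchy_schwarz (Psi j) y; rewrite (dot_unit (unit_Psi j)).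
have := mixture_energy_le c p s frame ltac:(lra); rewrite c_norm -/y.
have : A * 1 <= A * \sum_(j < K) noisy p i j s by apply: Rmult_le_compat_l; lra.
by rewrite /analysis; lra.
Qed.

Local Notation total_tilt := (\sum_(j < K) tilt_sqr j).

Lemma sum_linf_analysis_lt (p : {perm 'I_K}) (i : 'I_K) : p \in perm_fiber o i ->
  \sum_(s : {ffun 'I_K -> bool}) linf (analysis Psi (mixture Phi c p s)) ^ 2
  < 2 ^ K * (correlation_energy Phi c p (Psi i) + peak_excess K c / INR K * total_tilt).
Proof.
move=> p_fib; have A_ge1 := frame_const_ge1; have K_gt1R := INR_K_gt1.
apply: (Rle_lt_trans _ (\sum_(s : {ffun 'I_K -> bool})
    (dot (Psi i) (mixture Phi c p s) ^ 2 + A * \sum_(j < K) noisy p i j s))).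
  by apply: Rsum_le => s _; apply: linf_analysis_le.
rewrite big_split -big_distrr exchange_big sum_dot_mixture_sqr Rmult_plus_distr_l.
apply: Rplus_lt_compat_l.
have [j0 tilt_gt0] := exists_tilt_sqr_gt0.
have noisy_lt : \sum_(j < K) \sum_(s : {ffun 'I_K -> bool}) noisy p i j s
    < 2 ^ K * (peak_excess K c / (A * INR K) * total_tilt).
  rewrite !big_distrr; apply: (Rsum_lt j0) => // [j _|]; first exact: sum_noisy_le.
  exact: sum_noisy_lt.
apply: (Rlt_le_trans _ _ _ (Rmult_lt_compat_l A _ _ ltac:(lra) noisy_lt)).
by apply: Req_le; field; lra.
Qed.

Lemma sum_linf_analysis_ge (p : {perm 'I_K}) (i : 'I_K) :
  2 ^ K * correlation_energy Phi c p (Phi i)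
  <= \sum_(s : {ffun 'I_K -> bool}) linf (analysis Phi (mixture Phi c p s)) ^ 2.
Proof.
rewrite -sum_dot_mixture_sqr; apply: Rsum_le => s _.
exact: (linf_sqr_ge (analysis Phi (mixture Phi c p s)) i).
Qed.

Lemma sum_perm_fiber_peak_energy (i : 'I_K) :
  \sum_(p in perm_fiber o i) correlation_energy Phi c p (Phi i)
  = \sum_(p in perm_fiber o i) correlation_energy Phi c p (Psi i)
    + INR #|perm_fiber o i| * (peak_excess K c * tilt_sqr i).
Proof.
have := sum_perm_fiber_energy_gain c o i K_gt1 frame (unit_Psi i).
rewrite c_norm tilt_sqrE /peak_excess (_ : INR K.-1 = INR K - 1) => [<-|].
  by rewrite -big_split; apply: eq_bigr => p _ /=; ring.
by rewrite -subn1 minus_INR //; apply/leP/ltnW.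
Qed.

Lemma sum_tilted_energy :
  \sum_(i < K) \sum_(p in perm_fiber o i)
     (correlation_energy Phi c p (Psi i) + peak_excess K c / INR K * total_tilt)
  = \sum_(i < K) \sum_(p in perm_fiber o i) correlation_energy Phi c p (Phi i).
Proof.
pose n := INR #|perm_fiber o o|; have K_gt1R := INR_K_gt1.
transitivity (\sum_(i < K) (\sum_(p in perm_fiber o i) correlation_energy Phi c p (Psi i)
    + n * (peak_excess K c / INR K * total_tilt))).
  by apply: eq_bigr => i _; rewrite big_split Rsum_const (card_perm_fiber o i o).
transitivity (\sum_(i < K) (\sum_(p in perm_fiber o i) correlation_energy Phi c p (Psi i)
    + n * peak_excess K c * tilt_sqr i)).
  rewrite !big_split Rsum_const card_ord -big_distrr; congr (_ + _).
  by rewrite /=; field; lra.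
apply: eq_bigr => i _; rewrite sum_perm_fiber_peak_energy (card_perm_fiber o i o).
by rewrite Rmult_assoc.
Qed.

Lemma objective_lt : objective Phi c Psi < objective Phi c Phi.
Proof.
have K_gt1R := INR_K_gt1.
apply: Rmult_lt_compat_l.
  apply: Rinv_0_lt_compat; apply: Rmult_lt_0_compat; apply/lt_0_INR/ltP.
    by rewrite expn_gt0.
  exact: fact_gt0.
rewrite (sum_perm_fibers o) [X in _ < X](sum_perm_fibers o).
apply: (@Rlt_le_trans _ (2 ^ K * \sum_(i < K) \sum_(p in perm_fiber o i)
    (correlation_energy Phi c p (Psi i) + peak_excess K c / INR K * total_tilt))).
  rewrite big_distrr; apply: (Rsum_lt o) => // [i _|]; rewrite big_distrr.
    by apply: Rsum_le => p p_fib; apply/Rlt_le/sum_linf_analysis_lt.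
  apply: (Rsum_lt _ (perm_fiber_tperm o o)) => [p p_fib|].
    exact/Rlt_le/sum_linf_analysis_lt.
  exact/sum_linf_analysis_lt/perm_fiber_tperm.
rewrite sum_tilted_energy big_distrr; apply: Rsum_le => i _.
by rewrite big_distrr; apply: Rsum_le => p _; apply: sum_linf_analysis_ge.
Qed.

End Perturbation.
End GappedCoefficients.

Theorem theorem2 (d K : nat) (Phi : dict d K) (A : R) (c : nat -> R)
  (hd : (0 < d)%N) (hK : (1 < K)%N)
  (hframe : is_untf Phi A)
  (hA : A = INR K / INR d)
  (hsorted : forall i j : nat, (i <= j)%N -> (j < K)%N -> c j <= c i)
  (hnonneg : forall i : nat, (i < K)%N -> 0 <= c i)
  (hnorm : sqrt (\big[Rplus/0]_(i < K) (c i) ^ 2) = 1)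
  (hgap : c 0%N > c 1%N + 2 * coherence Phi * \big[Rplus/0]_(i < K) Rabs (c i)) :
  local_max_on_D (objective Phi c) Phi /\
  (forall eps : R,
     eps < / 5 ->
     eps <= (1 - 2 * ((c 1%N + coherence Phi * \big[Rplus/0]_(i < K) Rabs (c i))
                       / (c 1%N + c 0%N))) ^ 2
            / (2 * A * ln (2 * A * INR K
                           / ((c 0%N) ^ 2 - (1 - (c 0%N) ^ 2) / (INR K - 1)))) ->
     forall Psi : dict d K, in_D Psi ->
       0 < dict_dist Psi Phi -> dict_dist Psi Phi <= eps ->
       objective Phi c Psi < objective Phi c Phi).
Proof.
have unit_norm : \sum_(i < K) c i ^ 2 = 1.
  by rewrite -(pow2_sqrt _ (sum_sqr_ge0 _)) hnorm pow1.
have gap : c 1%N + 2 * interference Phi c < c 0%N by rewrite /interference; lra.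
have strict eps (eps_lt : eps < / 5) (eps_le : eps <= attraction_radius Phi A c) Psi :
    in_D Psi -> 0 < dict_dist Psi Phi -> dict_dist Psi Phi <= eps ->
    objective Phi c Psi < objective Phi c Phi.
  by move=> *; apply: objective_lt eps_lt eps_le _ _.
split; last exact: strict.
apply: (@local_max_of_strict_max _ _ _ _ (Rmin (/ 6) (attraction_radius Phi A c))).
  by apply: Rmin_pos; [lra|exact: attraction_radius_gt0].
apply: strict; last exact: Rmin_r.
by have := Rmin_l (/ 6) (attraction_radius Phi A c); lra.
Qed.
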